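(* Let $M$ be a compact Riemannian manifold. For all $r\geq 1$, the maps $$\mathbf{H}:(\mathrm{F}^{r}(\mathbf{M}),\tau_{str})\rightarrow \mathbb{R}\cup\{+\infty\}\quad\text{and}\quad \mathbf{H}^{(-1)}:(\mathrm{F}^{r}(\mathbf{M}),\tau_{str})\rightarrow \mathbb{R}\cup\{+\infty\}$$ are locally constant.
   Context: $M$ is a compact $C^r$ Riemannian manifold with the metric $d$ induced by the Riemannian norm. For $i\in\mathbb{Z}$ put $M_i=M\times\{i\}$, and let $\mathbf{M}=\coprod_{i\in\mathbb{Z}}M_i$ with the metric $\mathbf{d}(x,y)=\min\{1,d(x,y)\}$ if $x,y$ lie in the same $M_i$ and $\mathbf{d}(x,y)=1$ otherwise. $\mathrm{Diff}^{r}(M_i,M_{i+1})$ is the set of $C^r$-diffeomorphisms $M_i\to M_{i+1}$, with the $C^r$-metric $d^r$ induced by the Riemannian metric (the same metric for every $i$ under the identification $M_i\cong M$). $\mathrm{F}^{r}(\mathbf{M})=\prod_{i\in\mathbb{Z}}\mathrm{Diff}^{r}(M_i,M_{i+1})$ is the set of sequences $f=(f_i)_{i\in\mathbb{Z}}$ of $C^r$-diffeomorphisms $f_i:M_i\to M_{i+1}$. The strong topology $\tau_{str}$ on $\mathrm{F}^{r}(\mathbf{M})$ is generated by the sets $B^{r}(f,\varepsilon)=\{g=(g_i)_{i\in\mathbb{Z}}\in \mathrm{F}^r(\mathbf{M}): d^r(f_i,g_i)<\varepsilon_i \text{ for all } i\in\mathbb{Z}\}$, where $f\in \mathrm{F}^{r}(\mathbf{M})$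 and $\varepsilon=(\varepsilon_i)_{i\in\mathbb{Z}}$ is a sequence of positive numbers. Entropy. For $f=(f_i)_{i\in\mathbb{Z}}$ put $f_i^0=\mathrm{id}_{M_i}$ and $f_i^n=f_{i+n-1}\circ\cdots\circ f_i:M_i\to M_{i+n}$ for $n>0$. A compact set $K\subseteq M_i$ is an $(n,\varepsilon)$-span of $M_i$ with respect to $f$ if for each $x\in M_i$ there is $y\in K$ with $\max_{0\le j<n}\mathbf{d}(f_i^j(x),f_i^j(y))<\varepsilon$. Let $r[n,i](\varepsilon,f)$ be the smallest cardinality of an $(n,\varepsilon)$-span of $M_i$, $r[i](\varepsilon,f)=\limsup_{n\to+\infty}\frac1n\log r[n,i](\varepsilon,f)$, and $\mathbf{H}_i(f)=\lim_{\varepsilon\to0}r[i](\varepsilon,f)\in[0,+\infty]$. The value $\mathbf{H}_i(f)$ does not depend on $i$; the common value is denoted $\mathbf{H}(f)$. The inverse of $f$ is $f^{-1}=(g_i)_{i\in\mathbb{Z}}$ with $g_i=f_i^{-1}:M_{i+1}\to M_i$, with iterates $(f^{-1})_i^0=\mathrm{id}_{M_{i+1}}$ and $(f^{-1})_i^n=g_{i-n+1}\circ\cdots\circ g_i:M_{i+1}\to M_{i-n+1}$ for $n>0$. Define $\mathbf{H}^{(-1)}(f)=\mathbf{H}(f^{-1})$, i.e. the same entropy (again independent of $i$) computed with the iterates $(f^{-1})_i^n$ in place of $f_i^n$. A map is locally constant if each point has a neighbourhood on which it is constant. *)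

(* Defs.v *)
From HB Require Import structures.
From mathcomp Require Import all_boot all_order all_algebra.
From mathcomp Require Import all_classical all_reals all_analysis.

Set Implicit Arguments.
Unset Strict Implicit.
Unset Printing Implicit Defensive.

Import Order.TTheory GRing.Theory Num.Theory.
Import numFieldNormedType.Exports.

Local Open Scope classical_set_scope.
Local Open Scope card_scope.
Local Open Scope ring_scope.

(* partials [:: i1; ...; ik] F = D_i1 (... (D_ik F)) *)
Fixpoint partials (R : realType) (n : nat) (W : normedModType R)
    (s : seq 'I_n) (F : 'rV[R]_n -> W) {struct s} : 'rV[R]_n -> W :=
  if s is i :: s' then
    fun u => 'D_(delta_mx 0 i : 'rV[R]_n) (partials s' F) u
  else F.

(* F is of class C^k on U; meant for open U *)
Definition Ck (R : realType) (n : nat) (W : normedModType R) (k : nat)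
    (U : set 'rV[R]_n) (F : 'rV[R]_n -> W) : Prop :=
  (forall s : seq 'I_n, (size s <= k)%N ->
     forall u, U u -> {for u, continuous (partials s F)}) /\
  (forall (s : seq 'I_n) (i : 'I_n), (size s < k)%N ->
     forall u, U u -> derivable (partials s F) u (delta_mx 0 i : 'rV[R]_n)).

(* The maps are total; they are meaningful only on chart_dom and on its image
   respectively. *)
Record chart (R : realType) (n : nat) (M : topologicalType) := Chart {
  chart_dom : set M;
  chart_map : M -> 'rV[R]_n;
  chart_inv : 'rV[R]_n -> M;
  chart_dom_open : open chart_dom;
  chart_img_open : open (chart_map @` chart_dom);
  chart_mapK : forall x, chart_dom x -> chart_inv (chart_map x) = x;
  chart_map_cont : forall x, chart_dom x -> {for x, continuous chart_map};
  chart_inv_cont : forall u, (chart_map @` chart_dom) u ->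
    {for u, continuous chart_inv} }.

Record Cr_manifold (R : realType) (r n : nat) (M : topologicalType) :=
  CrManifold {
    atlas : set (chart R n M);
    chart_at : M -> chart R n M;
    chart_at_atlas : forall x, atlas (chart_at x);
    chart_at_dom : forall x, chart_dom (chart_at x) x;
    transition_Cr : forall c c', atlas c -> atlas c' ->
      Ck r (chart_map c @` (chart_dom c `&` chart_dom c'))
           (chart_map c' \o chart_inv c) }.

(* C^1 curves are taken to be defined on the whole line and are measured on
   [0, 1]. This gives the same infimum as (piecewise) C^1 curves on [0, 1]:
   reparametrise so that the velocity vanishes at the endpoints and corners,
   then extend by constants. *)
Definition C1_curve (R : realType) (r n : nat) (M : topologicalType)
    (A : Cr_manifold R r n M) (gam : R -> M) : Prop :=
  continuous gam /\
  forall t c, atlas A c -> chart_dom c (gam t) ->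
    derivable (chart_map c \o gam) t 1 /\
    {for t, continuous (derive1 (chart_map c \o gam))}.

Definition speed (R : realType) (r n : nat) (M : topologicalType)
    (A : Cr_manifold R r n M) (g : chart R n M -> 'rV[R]_n -> 'M[R]_n)
    (gam : R -> M) (t : R) : R :=
  let c := chart_at A (gam t) in
  let v : 'rV[R]_n := derive1 (chart_map c \o gam) t in
  Num.sqrt ((v *m g c (chart_map c (gam t)) *m v^T) 0 0).

Definition curve_length (R : realType) (r n : nat) (M : topologicalType)
    (A : Cr_manifold R r n M) (g : chart R n M -> 'rV[R]_n -> 'M[R]_n)
    (gam : R -> M) : \bar R :=
  (\int[lebesgue_measure]_(t in `[0%R, 1%R]) (speed A g gam t)%:E)%E.

(* +oo between distinct connected components *)
Definition riem_dist (R : realType) (r n : nat) (M : topologicalType)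
    (A : Cr_manifold R r n M) (g : chart R n M -> 'rV[R]_n -> 'M[R]_n)
    (x y : M) : \bar R :=
  ereal_inf [set curve_length A g gam |
    gam in [set gam | [/\ C1_curve A gam, gam 0 = x & gam 1 = y]]].

(* metric_mx c u is the Gram matrix, at the point of coordinates u in the chart
   c, of the inner product on the tangent space. A C^r atlas makes the tangent
   bundle, hence the metric tensor, of class C^(r-1). The metric structure
   carried by M is the Riemannian distance. *)
Record riemannian_manifold (R : realType) (r n : nat) (M : pseudoMetricType R) :=
  RiemannianManifold {
    manifold_of :> Cr_manifold R r n M;
    metric_mx : chart R n M -> 'rV[R]_n -> 'M[R]_n;
    metric_Cr : forall c, atlas manifold_of c ->
      Ck r.-1 (chart_map c @` chart_dom c) (metric_mx c);
    metric_sym : forall c x, atlas manifold_of c -> chart_dom c x ->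
      (metric_mx c (chart_map c x))^T = metric_mx c (chart_map c x);
    metric_pos : forall c x, atlas manifold_of c -> chart_dom c x ->
      forall v : 'rV[R]_n, v != 0 ->
        0 < (v *m metric_mx c (chart_map c x) *m v^T) 0 0;
    metric_compat : forall c c' x, atlas manifold_of c -> atlas manifold_of c' ->
      chart_dom c x -> chart_dom c' x ->
      forall v w : 'rV[R]_n,
        let tau := chart_map c' \o chart_inv c in
        let u := chart_map c x in
        v *m metric_mx c u *m w^T =
        ('D_v tau u : 'rV[R]_n) *m metric_mx c' (tau u)
          *m ('D_w tau u : 'rV[R]_n)^T;
    riem_ballE : forall (x y : M) (e : R), 0 < e ->
      ball x e y <-> (riem_dist manifold_of metric_mx x y < e%:E)%E }.

Definition local_rep (R : realType) (n : nat) (M : topologicalType)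
    (c c' : chart R n M) (f : M -> M) : 'rV[R]_n -> 'rV[R]_n :=
  chart_map c' \o f \o chart_inv c.

Definition Cr_map (R : realType) (r n : nat) (M : topologicalType)
    (A : Cr_manifold R r n M) (f : M -> M) : Prop :=
  continuous f /\
  forall c c', atlas A c -> atlas A c' ->
    Ck r (chart_map c @` (chart_dom c `&` f @^-1` chart_dom c'))
         (local_rep c c' f).

(* As M_i is identified with M, this is Diff^r(M_i, M_{i+1}) for every i. *)
Record Diff (R : realType) (r n : nat) (M : topologicalType)
    (A : Cr_manifold R r n M) := MkDiff {
  dfun :> M -> M;
  dinv : M -> M;
  dfunK : cancel dfun dinv;
  dinvK : cancel dinv dfun;
  dfun_Cr : Cr_map A dfun;
  dinv_Cr : Cr_map A dinv }.

(* open sets of the topology generated by the subbase B *)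
Definition generated_open (T : Type) (B : set (set T)) (O : set T) : Prop :=
  forall x, O x -> exists F : set (set T),
    [/\ finite_set F, F `<=` B,
        (\bigcap_(b in F) b) x & \bigcap_(b in F) b `<=` O].

Definition Cr_nbhd (R : realType) (r n : nat) (M : topologicalType)
    (A : Cr_manifold R r n M) (f : Diff A) (c c' : chart R n M)
    (K : set M) (e : R) : set (Diff A) :=
  [set h : Diff A | forall x, K x -> chart_dom c' (h x) /\
     forall s : seq 'I_n, (size s <= r)%N ->
       `| partials s (local_rep c c' f) (chart_map c x)
          - partials s (local_rep c c' h) (chart_map c x) | < e].

(* the usual C^r topology: uniform convergence, on compact subsets of charts,
   of the local representatives and their derivatives of order at most r *)
Definition Cr_open (R : realType) (r n : nat) (M : topologicalType)
    (A : Cr_manifold R r n M) : set (Diff A) -> Prop :=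
  generated_open [set N | exists (f : Diff A) c c' (K : set M) (e : R),
    [/\ atlas A c /\ atlas A c', compact K /\ K `<=` chart_dom c,
        f @` K `<=` chart_dom c', 0 < e & N = Cr_nbhd f c c' K e]].

(* dr is a C^r metric: a metric inducing the C^r topology. A formula for one
   needs auxiliary choices (finite atlas, embedding); all the choices induce the
   same topology on Diff, hence the same strong topology below. *)
Definition Cr_metric (R : realType) (r n : nat) (M : topologicalType)
    (A : Cr_manifold R r n M) (dr : Diff A -> Diff A -> R) : Prop :=
  [/\ forall f g, dr f g = 0 <-> f = g,
      forall f g, dr f g = dr g f,
      forall f g h, dr f h <= dr f g + dr g h &
      forall O : set (Diff A),
        (forall f, O f -> exists2 e : R, 0 < e & forall g, dr f g < e -> O g)
        <-> Cr_open O].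

Definition Fr (R : realType) (r n : nat) (M : topologicalType)
    (A : Cr_manifold R r n M) : Type := int -> Diff A.

Definition strong_ball (R : realType) (r n : nat) (M : topologicalType)
    (A : Cr_manifold R r n M) (dr : Diff A -> Diff A -> R)
    (f : Fr A) (eps : int -> R) : set (Fr A) :=
  [set g : Fr A | forall i, dr (f i) (g i) < eps i].

Definition strong_open (R : realType) (r n : nat) (M : topologicalType)
    (A : Cr_manifold R r n M) (dr : Diff A -> Diff A -> R) :
    set (Fr A) -> Prop :=
  generated_open [set B | exists (f : Fr A) (eps : int -> R),
    (forall i, 0 < eps i) /\ B = strong_ball dr f eps].

(* the distance on the disjoint union of the M_i = M x {i} *)
Definition total_dist (R : realType) (r n : nat) (M : pseudoMetricType R)
    (X : riemannian_manifold r n M) (p q : M * int) : \bar R :=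
  if p.2 == q.2 then Order.min 1%E (riem_dist X (metric_mx X) p.1 q.1) else 1%E.

(* f_i^k : M_i -> M_{i+k} *)
Fixpoint fwd_iter (R : realType) (r n : nat) (M : topologicalType)
    (A : Cr_manifold R r n M) (f : Fr A) (i : int) (k : nat) (x : M) {struct k}
    : M :=
  if k is k'.+1 then f (i + k'%:Z) (fwd_iter f i k' x) else x.

(* (f^-1)_i^k : M_{i+1} -> M_{i-k+1} *)
Fixpoint bwd_iter (R : realType) (r n : nat) (M : topologicalType)
    (A : Cr_manifold R r n M) (f : Fr A) (i : int) (k : nat) (x : M) {struct k}
    : M :=
  if k is k'.+1 then dinv (f (i - k'%:Z)) (bwd_iter f i k' x) else x.

Definition fwd_orbit (R : realType) (r n : nat) (M : topologicalType)
    (A : Cr_manifold R r n M) (f : Fr A) (i : int) (k : nat) (x : M) : M * int :=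
  (fwd_iter f i k x, i + k%:Z).

Definition bwd_orbit (R : realType) (r n : nat) (M : topologicalType)
    (A : Cr_manifold R r n M) (f : Fr A) (i : int) (k : nat) (x : M) : M * int :=
  (bwd_iter f i k x, i - k%:Z + 1).

Definition is_span (R : realType) (r n : nat) (M : pseudoMetricType R)
    (X : riemannian_manifold r n M) (orb : nat -> M -> M * int)
    (k : nat) (eps : R) (K : set M) : Prop :=
  compact K /\
  forall x, exists2 y, K y & forall j, (j < k)%N ->
    (total_dist X (orb j x) (orb j y) < eps%:E)%E.

Definition span_number (R : realType) (r n : nat) (M : pseudoMetricType R)
    (X : riemannian_manifold r n M) (orb : nat -> M -> M * int)
    (k : nat) (eps : R) : \bar R :=
  ereal_inf [set (m%:R)%:E |
    m in [set m : nat | exists2 K, is_span X orb k eps K & K #= `I_m]].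

Definition span_rate (R : realType) (r n : nat) (M : pseudoMetricType R)
    (X : riemannian_manifold r n M) (orb : nat -> M -> M * int)
    (eps : R) : \bar R :=
  limn_esup (fun k => ((k%:R^-1)%:E * lne (span_number X orb k eps))%E).

Definition orbit_entropy (R : realType) (r n : nat) (M : pseudoMetricType R)
    (X : riemannian_manifold r n M) (orb : nat -> M -> M * int) : \bar R :=
  lim (span_rate X orb eps @[eps --> 0^'+]).

Definition entropy (R : realType) (r n : nat) (M : pseudoMetricType R)
    (X : riemannian_manifold r n M) (i : int) (f : Fr X) : \bar R :=
  orbit_entropy X (fwd_orbit f i).

Definition inv_entropy (R : realType) (r n : nat) (M : pseudoMetricType R)
    (X : riemannian_manifold r n M) (i : int) (f : Fr X) : \bar R :=
  orbit_entropy X (bwd_orbit f i).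

Definition locally_constant (T U : Type) (opn : set T -> Prop) (F : T -> U)
    : Prop :=
  forall x, exists O : set T, [/\ opn O, O x & forall y, O y -> F y = F x].

(* Main.v *)
(* Only the C^0 size of the perturbation matters. If the radii eps_i decrease
   fast enough (depending on f), then any g in the strong ball around f satisfies
   Psi_j = Phi_j o h_n up to an error 1/(j+1) for all j < n, where Phi_j, Psi_j
   are the iterates of f, g and h_n = Phi_n^-1 o Psi_n is a bijection of M. Since
   the errors tend to 0, at a given scale only finitely many times j are not
   controlled by this conjugacy, uniformly in n, and they cost a bounded factor in
   the span numbers, which does not change their exponential growth rate. *)
Require Import Defs.
From mathcomp Require Import all_boot all_order all_algebra.
From mathcomp Require Import all_classical all_reals all_analysis.
From mathcomp Require Import zify lra.
Import numFieldNormedType.Exports.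

Set Implicit Arguments.
Unset Strict Implicit.
Unset Printing Implicit Defensive.

Import Order.TTheory GRing.Theory Num.Theory.

Local Open Scope classical_set_scope.
Local Open Scope card_scope.
Local Open Scope ring_scope.

(** * Uniform estimates from compactness *)

(** Heine-Cantor with the second point free to leave [K], as [f] is continuous at points of [K]
    within all of [T]. This matters for chart inverses, where a perturbed point may lie outside the
    compact set. *)
Lemma compact_modulus (R : realType) (T U : pseudoMetricType R) (K : set T)
    (f : T -> U) (d : R) :
  compact K -> (forall x, K x -> {for x, continuous f}) -> 0 < d ->
  exists2 e : R, 0 < e &
    forall x y, K x -> ball x e y -> ball (f x) d (f y).
Proof.
move=> /compact_near_coveringP cK fK d0.
have [|e e0 He] := cK R (0^'+)
  (fun e x => forall y, ball x e y -> ball (f x) d (f y)) _.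
  move=> x Kx.
  have d20 : 0 < d / 2 by rewrite divr_gt0.
  have : \forall y \near x, ball (f x) (d / 2) (f y).
    by apply: fK => //; apply: nbhsx_ballx.
  move=> /nbhs_ballP[r /= r0 fr].
  have r20 : 0 < r / 2 by rewrite divr_gt0.
  exists (ball x (r / 2), [set e | e < r / 2]) => /=.
    split; first exact: nbhsx_ballx.
    exact: nbhs_right_lt.
  move=> [x' e] /= [xx' er] y x'y.
  rewrite (splitr d); apply: (ball_triangle (y := f x)).
    apply/ball_sym/fr.
    by apply: le_ball xx'; lra.
  apply: fr.
  rewrite (splitr r); apply: ball_triangle xx' _.
  by apply: le_ball x'y; apply: ltW.
exists (e / 2) => /=; first by rewrite divr_gt0.
move=> x y Kx xy; apply: (He (e / 2)) => //=.
  rewrite sub0r normrN gtr0_norm ?divr_gt0 //.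
  by move: e0 => /=; lra.
by rewrite divr_gt0.
Qed.

Lemma compact_finite_net (R : realType) (T : pseudoMetricType R) (e : R) :
  compact [set: T] -> 0 < e ->
  exists s : seq T, forall x, exists2 p, p \in s & ball p e x.
Proof.
move=> /compact_near_coveringP cT e0.
(* Eventually for [F] means for every list containing some fixed list; compactness then yields one
   list good for all points. *)
pose F : set_system (seq T) :=
  filter_from setT (fun s0 : seq T => [set s : seq T | {subset s0 <= s}]).
have FF : Filter F.
  apply: filter_from_filter; first by exists [::].
  move=> s t _ _; exists (s ++ t) => // u su; split=> z zs; apply: su;
    by rewrite mem_cat zs ?orbT.
have [|s _ Hs] := cT _ F (fun s x => exists2 p, p \in s & ball p e x) FF.
  move=> x _; exists (ball x e, [set s | x \in s]) => /=.
    split; first exact: nbhsx_ballx.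
    by exists [:: x] => // s /(_ x); apply; rewrite inE.
  by move=> [y s] /= [xy xs]; exists x.
by exists s => x; apply: (Hs s).
Qed.

(** The label of a point is the position of the first net point close to it, so equally labelled
    points are close to a common centre. *)
Lemma finite_labelling (R : realType) (T : pseudoMetricType R)
    (Psi : nat -> T -> T) (N : nat) (e : R) :
  compact [set: T] -> (forall j, continuous (Psi j)) -> 0 < e ->
  exists (L : nat) (lab : T -> nat), (forall x, (lab x < L)%N) /\
    forall x y, lab x = lab y ->
      forall j, (j < N)%N -> ball (Psi j x) e (Psi j y).
Proof.
move=> cT cPsi e0.
have [d d0 Hd] : exists2 d : R, 0 < d & forall j, (j < N)%N ->
    forall x y, ball x d y -> ball (Psi j x) (e / 2) (Psi j y).
  elim: N => [|N [d d0 IH]]; first by exists 1.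
  have e20 : 0 < e / 2 by rewrite divr_gt0.
  have [|d' d'0 Hd'] := @compact_modulus _ _ _ _ (Psi N) _ cT _ e20.
    by move=> x _; exact: cPsi.
  exists (Num.min d d'); first by rewrite lt_min d0.
  move=> j; rewrite ltnS leq_eqVlt => /predU1P[->|jN] x y xy.
    by apply: Hd' => //; apply: le_ball xy; rewrite ge_min lexx orbT.
  by apply: IH => //; apply: le_ball xy; rewrite ge_min lexx.
have [s Hs] := compact_finite_net cT d0.
pose lab x := find (fun p => `[< ball p d x >]) s.
have has_lab x : has (fun p => `[< ball p d x >]) s.
  by have [p ps px] := Hs x; apply/hasP; exists p => //; apply/asboolP.
exists (size s), lab; split=> [x|x y xy j jN]; first by rewrite -has_find.
have := nth_find x (has_lab x); have := nth_find x (has_lab y).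
rewrite -/(lab x) -/(lab y) -xy => /asboolP py /asboolP px.
rewrite (splitr e); apply: (ball_triangle (y := Psi j (nth x s (lab x)))).
  by apply: ball_sym; apply: Hd.
exact: Hd.
Qed.

(** * Counting, and exponential growth rates *)

Lemma card_le_image_II (T : Type) (K : set T) (F : nat -> T) (p : nat) :
  K `<=` F @` `I_p -> exists2 m, (m <= p)%N & K #= `I_m.
Proof.
move=> KF; have Kp : K #<= `I_p.
  by apply: card_le_trans (card_image_le F `I_p); apply: subset_card_le.
have /finite_setP[m Km] : finite_set K by apply: card_le_finite Kp _.
by exists m => //; rewrite -card_le_II -(card_le_eql Km).
Qed.

Lemma card_eq_II_image (T : choiceType) (K : set T) (m : nat) (x : T) :
  K #= `I_m -> exists F : nat -> T, K `<=` F @` `I_m.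
Proof.
case/card_set_bijP => f [fK finj _].
exists (fun i => xget x (K `&` f @^-1` [set i])) => y Ky.
exists (f y); first exact: fK.
have [Kz fz] : (K `&` f @^-1` [set f y]) (xget x (K `&` f @^-1` [set f y])).
  by apply: xgetPex; exists y.
by apply: finj => //; rewrite inE.
Qed.

Lemma limn_esup_le_near (R : realType) (u v : nat -> \bar R) (e : R) :
  (\forall k \near \oo, (u k <= v k + e%:E)%E) ->
  (limn_esup u <= limn_esup v + e%:E)%E.
Proof.
move=> uv; rewrite -leeBlDr //; apply: le_ereal_inf_tmp => _ /= [V nV <-].
(* The upper limit is an infimum of suprema over eventual sets, so [V] may be cut down to where the
   bound holds. *)
rewrite EFinN leeBlDr //; apply: (@le_trans _ _ (ereal_sup
  [set u x | x in V `&` [set k | (u k <= v k + e%:E)%E]])).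
  apply: ereal_inf_lbound; exists (V `&` [set k | (u k <= v k + e%:E)%E]) => //.
  exact: filterI.
apply: ge_ereal_sup => _ [k [Vk uvk] <-]; apply: le_trans uvk _.
by rewrite leeD2r //; apply: ereal_sup_ubound; exists k.
Qed.

Lemma le_lne (R : realType) (x y : \bar R) : (x <= y -> lne x <= lne y)%E.
Proof.
move=> xy; have [x0|x0] := leP x 0%E; first by rewrite le0_lneNy ?leNye.
by rewrite lee_lne // in_itv /= leey andbT ltW //; exact: lt_le_trans xy.
Qed.

Lemma lneM_le (R : realType) (L : R) (x : \bar R) :
  0 < L -> (lne (L%:E * x) <= lne x + (ln L)%:E)%E.
Proof.
move=> L0; have [x0|x0] := leP x 0%E.
  by rewrite le0_lneNy ?leNye //; apply: mule_ge0_le0 => //; rewrite lee_fin ltW.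
by rewrite lneM ?lne_EFin 1?addeC // in_itv /= leey andbT ?lte_fin.
Qed.

(** The factor [L] contributes only [ln L / k], which tends to 0. *)
Lemma growth_rate_le (R : realType) (u v : nat -> \bar R) (L : R) :
  0 < L -> (forall k, (u k <= L%:E * v k)%E) ->
  (limn_esup (fun k => (k%:R^-1)%:E * lne (u k)) <=
   limn_esup (fun k => (k%:R^-1)%:E * lne (v k)))%E.
Proof.
move=> L0 uv; apply/lee_addgt0Pr => e e0; apply: limn_esup_le_near.
near=> k.
have k0 : (0 < k)%N by near: k; exact: nbhs_infty_gt.
have kR : 0 < k%:R :> R by rewrite ltr0n.
apply: (@le_trans _ _ ((k%:R^-1)%:E * (lne (v k) + (ln L)%:E))%E).
  rewrite lee_pmul2l ?lte_fin ?invr_gt0 //.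
  exact: le_trans (le_lne (uv k)) (lneM_le _ L0).
rewrite muleDr // ?fin_num_adde_defl // leeD2l // -EFinM lee_fin.
rewrite mulrC ler_pdivrMr // mulrC -ler_pdivrMr //.
near: k; exact: nbhs_infty_ger.
Unshelve. all: by end_near. Qed.

(** * Almost conjugating perturbed orbits *)

Section Perturbation.
Context (R : realType) (M : pseudoMetricType R).
Context (cM : compact [set: M]).

Fixpoint orbit_map (F : nat -> M -> M) (k : nat) (x : M) : M :=
  if k is k'.+1 then F k' (orbit_map F k' x) else x.

Fixpoint orbit_inv (F' : nat -> M -> M) (k : nat) (x : M) : M :=
  if k is k'.+1 then orbit_inv F' k' (F' k' x) else x.

Lemma orbit_mapK (F F' : nat -> M -> M) k :
  (forall j, cancel (F j) (F' j)) -> cancel (orbit_map F k) (orbit_inv F' k).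
Proof. by move=> FK; elim: k => [|k IH] x //=; rewrite FK. Qed.

Lemma orbit_invK (F F' : nat -> M -> M) k :
  (forall j, cancel (F' j) (F j)) -> cancel (orbit_inv F' k) (orbit_map F k).
Proof. by move=> FK; elim: k => [|k IH] x //=; rewrite IH FK. Qed.

Lemma orbit_map_continuous (F : nat -> M -> M) k :
  (forall j, continuous (F j)) -> continuous (orbit_map F k).
Proof.
move=> cF; elim: k => [|k IH] x; first exact: cvg_id.
apply: (@continuous_comp _ _ _ (orbit_map F k) (F k)); [exact: IH|exact: cF].
Qed.

Lemma orbit_inv_continuous (F' : nat -> M -> M) k :
  (forall j, continuous (F' j)) -> continuous (orbit_inv F' k).
Proof.
move=> cF; elim: k => [|k IH] x; first exact: cvg_id.
apply: (@continuous_comp _ _ _ (F' k) (orbit_inv F' k)); [exact: cF|exact: IH].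
Qed.

(* With [Phi], [Psi] the orbit maps of [F], [G], the conjugacy is
   [h_n = Phi_n^-1 Psi_n]. Since [h_{k+1} = Phi_{k+1}^-1 G_k Psi_k] and
   [h_k = Phi_{k+1}^-1 F_k Psi_k], a small enough [eta k] makes them as close
   as desired; the bounds are summable and adapted to the moduli of continuity
   of [Phi_0, ..., Phi_k], so that [Phi_j h_n] stays near [Phi_j h_j = Psi_j]. *)
Lemma orbits_conjugate (F F' : nat -> M -> M) :
  (forall j, cancel (F j) (F' j)) -> (forall j, cancel (F' j) (F j)) ->
  (forall j, continuous (F j)) -> (forall j, continuous (F' j)) ->
  exists eta : nat -> R, (forall k, 0 < eta k) /\
  forall G G' : nat -> M -> M,
    (forall j, cancel (G j) (G' j)) -> (forall j, cancel (G' j) (G j)) ->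
    (forall k x, ball (F k x) (eta k) (G k x)) ->
  forall n, exists h h' : M -> M, [/\ cancel h h', cancel h' h &
    forall j x, (j < n)%N ->
      ball (orbit_map F j (h x)) j.+1%:R^-1 (orbit_map G j x)].
Proof.
move=> FK F'K cF cF'.
have /choice[m Hm] : forall k, exists e : R, 0 < e /\
    forall x y, ball x e y ->
      ball (orbit_map F k x) k.+1%:R^-1 (orbit_map F k y).
  move=> k; have [|//|e e0 He] := compact_modulus cM
    (f := orbit_map F k) (d := k.+1%:R^-1) _ _.
    by move=> x _; exact: orbit_map_continuous.
  by exists e; split=> // x y; exact: He.
pose e k := \big[Num.min/1]_(j < k.+1) m j / 2 ^+ k.+2.
have e0 k : 0 < e k.
  rewrite divr_gt0 ?exprn_gt0 //; apply/lt_bigmin => //.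
  by move=> j _; have [] := Hm j.
have em j k : (j <= k)%N -> e k <= m j / 2 ^+ k.+2.
  move=> jk; rewrite ler_pM2r ?invr_gt0 ?exprn_gt0 //.
  exact: (bigmin_le _ (Ordinal (jk : (j < k.+1)%N)) (fun i : 'I_k.+1 => m i)).
have /choice[eta Heta] : forall k, exists d : R, 0 < d /\
    forall x y, ball x d y ->
      ball (orbit_inv F' k.+1 x) (e k) (orbit_inv F' k.+1 y).
  move=> k; have [||d d0 Hd] := compact_modulus cM
    (f := orbit_inv F' k.+1) (d := e k) _ _.
  - by move=> x _; exact: orbit_inv_continuous.
  - exact: e0.
  by exists d; split=> // x y; exact: Hd.
exists eta; split=> [k|G G' GK G'K FG n]; first by have [] := Heta k.
pose h k x := orbit_inv F' k (orbit_map G k x).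
have hS k x : ball (h k x) (e k) (h k.+1 x).
  have [_ /(_ _ _ (FG k (orbit_map G k x)))] := Heta k.
  by rewrite /h /= FK.
(* Summing the geometric bounds [e k], the radius stays below [m j] for every [k], and it is already
   positive at [k = j], where [ballxx] requires this. *)
have hn j x k : (j <= k)%N ->
    ball (h j x) (m j * (1 - (2 ^+ k.+1)^-1)) (h k x).
  elim: k => [|k IH].
    rewrite leqn0 => /eqP ->; apply: ballxx.
    by have [m0 _] := Hm 0%N; rewrite expr1; lra.
  rewrite leq_eqVlt => /predU1P[->|].
    apply: ballxx; have [m0 _] := Hm k.+1.
    rewrite mulr_gt0 // subr_gt0 invf_lt1 ?exprn_gt0 //.
    by rewrite exprn_egt1 // ltr1n.
  rewrite ltnS => jk; have := ball_triangle (IH jk) (hS k x).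
  apply: le_ball; have := em _ _ jk.
  suff <- : m j * (1 - (2 ^+ k.+1)^-1) + m j / 2 ^+ k.+2 =
    m j * (1 - (2 ^+ k.+2)^-1) by rewrite lerD2l.
  have -> : (2 ^+ k.+1)^-1 = 2 * (2 ^+ k.+2)^-1 :> R.
    by rewrite [2 ^+ k.+2]exprS invfM mulrA divff ?mul1r.
  by lra.
exists (h n), (fun x => orbit_inv G' n (orbit_map F n x)); split.
- by move=> x; rewrite /h orbit_invK // orbit_mapK.
- by move=> x; rewrite /h orbit_invK // orbit_mapK.
move=> j x jn; have [mj /(_ (h n x) (h j x))] := Hm j.
rewrite {2}/h orbit_invK //; apply; apply: ball_sym.
apply: le_ball (hn j x n (ltnW jn)).
by rewrite ler_piMr ?(ltW mj) // gerBl invr_ge0 exprn_ge0.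
Qed.
End Perturbation.

(** * Comparing entropies of shadowing orbits *)

Section Entropy.
Context (R : realType) (r n : nat) (M : pseudoMetricType R).
Context (X : riemannian_manifold r n M).

Definition indexed_orbit (Phi : nat -> M -> M) (idx : nat -> int) (k : nat)
  (x : M) : M * int := (Phi k x, idx k).

(** The truncation at 1 is invisible at radii at most 1. *)
Lemma total_dist_ball (x y : M) (i : int) (e : R) : 0 < e -> e <= 1 ->
  (total_dist X (x, i) (y, i) < e%:E)%E <-> ball x e y.
Proof.
move=> e0 e1; rewrite /total_dist /= eqxx gt_min lte_fin (le_gtF e1) /=.
exact: iff_sym (riem_ballE X x y e0).
Qed.

(* The closeness hypothesis is too weak at the times [j < N] with
   [N ~ 2 / e]; there [Psi j] is controlled by a finite labelling of [M], so a
   span for [Psi] is obtained by choosing, for each point [y] of a span for [Phi]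
   and each label [l], one point labelled [l] that is shadowed by [y]. *)
Lemma span_number_le_near (Phi Psi : nat -> M -> M) (idx idx' : nat -> int)
    (e : R) :
  compact [set: M] -> (forall j, continuous (Psi j)) ->
  (forall k, exists h : M -> M, forall j x, (j < k)%N ->
     ball (Phi j (h x)) j.+1%:R^-1 (Psi j x)) ->
  0 < e -> 3 * e <= 1 ->
  exists2 L : R, 0 < L & forall k,
    (span_number X (indexed_orbit Psi idx') k (3 * e) <=
     L%:E * span_number X (indexed_orbit Phi idx) k e)%E.
Proof.
move=> cM cPsi close e0 e1.
have e20 : 0 < e / 2 by rewrite divr_gt0.
have [N _ HN] := near_infty_natSinv_lt (PosNum e20).
have e30 : 0 < 3 * e by rewrite mulr_gt0.
have [L [lab [labL Hlab]]] := finite_labelling N cM cPsi e30.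
exists L.+1%:R => // k; rewrite -ereal_inf_pZl //.
apply: le_ereal_inf_tmp => _ [_ [m [K [cK spanK] Km] <-] <-].
rewrite -EFinM -natrM; apply: ge_ereal_inf.
(* An empty span forces [M] to be empty, and then it also spans for [Psi]; otherwise [x0] serves as
   a default value. *)
have [K0|/set0P[x0 _]] := eqVneq K set0.
  exists m%:R%:E; last by rewrite lee_fin ler_nat leq_pmull.
  exists m => //; exists K => //; split=> // x.
  by have [y] := spanK x; rewrite K0.
have [kf Kkf] := card_eq_II_image x0 Km.
have [h Hh] := close k.
pose P y l := [set w | lab w = l /\
  forall j, (j < k)%N -> ball (Phi j (h w)) e (Phi j y)].
pose z y l := xget y (P y l).
(* A pair of span index [i] and label [l] is coded as [i * L.+1 + l]; the successor keeps the
   divisor positive. *)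
pose K' := (fun t => z (kf (t %/ L.+1)%N) (t %% L.+1)%N) @` `I_(L.+1 * m).
have [m' m'm K'm'] := card_le_image_II (@subset_refl _ K').
exists m'%:R%:E; last by rewrite lee_fin ler_nat.
exists m' => //; exists K' => //; split.
  by apply: finite_compact; apply/finite_setP; exists m'.
move=> x; have [y Ky Hy] := spanK (h x).
have yP : P y (lab x) x.
  split=> // j jk; apply/(@total_dist_ball _ _ (idx j)) => //; last exact: Hy.
  by lra.
have [labz Hz] : P y (lab x) (z y (lab x)) by apply: xgetPex; exists x.
exists (z y (lab x)).
  have [i im iy] := Kkf _ Ky.
  exists (i * L.+1 + lab x)%N => /=; last first.
    by rewrite divnMDl // modnMDl divn_small ?modn_small ?addn0 ?iy // ltnS ltnW.
  by rewrite mulnC; have := labL x; move: im => /=; nia.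
move=> j jk; apply/total_dist_ball => //.
have [jN|Nj] := ltnP j N; first exact: Hlab.
have je : j.+1%:R^-1 <= e / 2 by apply/ltW/(HN j).
(* With [z] the chosen point, the chain is [Psi j x], [Phi j (h x)], [Phi j y], [Phi j (h z)],
   [Psi j z]. *)
have -> : 3 * e = e / 2 + e + (e + e / 2) by lra.
apply: (ball_triangle (y := Phi j y)).
  apply: (ball_triangle (y := Phi j (h x))); last by have [_] := yP; exact.
  by apply: le_ball je _ _; apply/ball_sym/Hh.
apply: (ball_triangle (y := Phi j (h (z y (lab x))))).
  by apply/ball_sym/Hz.
by apply: le_ball je _ _; apply: Hh.
Qed.

Lemma span_rate_nonincreasing (orb : nat -> M -> M * int) (e e' : R) :
  e <= e' -> (span_rate X orb e' <= span_rate X orb e)%E.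
Proof.
move=> ee'; apply: (growth_rate_le ltr01) => k; rewrite mul1e.
apply: ereal_inf_le_tmp => _ [m [K [cK spanK] Km] <-]; exists m => //.
exists K => //; split=> // x; have [y Ky Hy] := spanK x.
by exists y => // j jk; apply: lt_le_trans (Hy j jk) _; rewrite lee_fin.
Qed.

(** The rate grows as the scale shrinks, so the limit is a supremum; scales below 1 suffice and
    avoid the truncation of the distance. *)
Lemma orbit_entropyE (orb : nat -> M -> M * int) :
  orbit_entropy X orb = ereal_sup (span_rate X orb @` [set` `]0, 1[]).
Proof.
apply: cvg_lim => //; apply: (nonincreasing_at_right_cvge (BLeft 1)).
  by rewrite bnd_simp.
by move=> x y _ _; exact: span_rate_nonincreasing.
Qed.

Lemma orbit_entropy_le_near (Phi Psi : nat -> M -> M) (idx idx' : nat -> int) :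
  compact [set: M] -> (forall j, continuous (Psi j)) ->
  (forall k, exists h : M -> M, forall j x, (j < k)%N ->
     ball (Phi j (h x)) j.+1%:R^-1 (Psi j x)) ->
  (orbit_entropy X (indexed_orbit Psi idx') <=
   orbit_entropy X (indexed_orbit Phi idx))%E.
Proof.
move=> cM cPsi close; rewrite !orbit_entropyE.
apply: ge_ereal_sup => _ [e] + <-; rewrite /= in_itv /= => /andP[e0 e1].
(* The loss of a factor 3 in scale disappears in the supremum over all scales. *)
apply: (@le_trans _ _ (span_rate X (indexed_orbit Phi idx) (e / 3))); last first.
  by apply: ereal_sup_ubound; exists (e / 3) => //=; rewrite in_itv /=; lra.
have e30 : 0 < e / 3 by lra.
have e31 : 3 * (e / 3) <= 1 by lra.
have [L L0 HL] := span_number_le_near idx idx' cM cPsi close e30 e31.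
by apply: (growth_rate_le L0) => k; have := HL k; rewrite mulrC divfK.
Qed.
End Entropy.

(** * From the metric [dr] to uniform closeness of maps and inverses *)

Section UniformCloseness.
Context (R : realType) (r n : nat) (M : pseudoMetricType R).
Context (A : Cr_manifold R r n M) (dr : Diff A -> Diff A -> R).
Context (cM : compact [set: M]) (dr_Cr : Cr_metric dr).

Lemma Diff_continuous (f : Diff A) : continuous f.
Proof. by have [] := dfun_Cr f. Qed.

Lemma dinv_continuous (f : Diff A) : continuous (Defs.dinv f).
Proof. by have [] := dinv_Cr f. Qed.

Lemma Cr_nbhd_dr_ball (f : Diff A) (c c' : chart R n M) (K : set M) (e : R) :
  atlas A c -> atlas A c' -> compact K -> K `<=` chart_dom c ->
  f @` K `<=` chart_dom c' -> 0 < e ->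
  exists2 d : R, 0 < d & forall g, dr f g < d -> Cr_nbhd f c c' K e g.
Proof.
move=> Ac Ac' cK Kc fKc' e0; have [_ _ _ drO] := dr_Cr.
have /drO : Cr_open (Cr_nbhd f c c' K e).
  move=> g Ng; exists [set Cr_nbhd f c c' K e]; split.
  - exact: finite_set1.
  - by move=> _ ->; exists f, c, c', K, e.
  - by move=> _ ->.
  - by move=> h; apply.
apply; move=> x Kx; split; first by apply: fKc'; exists x.
by move=> s _; rewrite subrr normr0.
Qed.

Lemma dr_ball_locally_close (f : Diff A) (x0 : M) (e : R) : 0 < e ->
  exists d rho : R, [/\ 0 < d, 0 < rho & forall g x,
    dr f g < d -> ball x0 rho x -> ball (f x) e (g x)].
Proof.
move=> e0; pose c := chart_at A x0; pose c' := chart_at A (f x0).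
have : nbhs x0 (chart_dom c `&` f @^-1` chart_dom c').
  apply: filterI.
    exact: open_nbhs_nbhs (conj (chart_dom_open c) (chart_at_dom A x0)).
  apply: Diff_continuous.
  exact: open_nbhs_nbhs (conj (chart_dom_open c') (chart_at_dom A (f x0))).
move=> /nbhs_ballP[rho /= rho0 Hrho].
have rho20 : 0 < rho / 2 by rewrite divr_gt0.
(* Halving the radius keeps the closure, which is compact, inside the ball of radius [rho]. *)
pose K := closure (ball x0 (rho / 2)).
have K_dom x : K x -> chart_dom c x /\ chart_dom c' (f x).
  move=> /(_ _ (nbhsx_ballx x _ rho20))[y [x0y xy]].
  apply: Hrho; rewrite (splitr rho); apply: ball_triangle x0y _.
  exact: ball_sym.
have cK : compact K.
  exact: subclosed_compact (@closed_closure _ _) cM (@subsetT _ _).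
have cfK : compact ((chart_map c' \o f) @` K).
  apply: continuous_compact cK; apply: continuous_in_subspaceT => x /set_mem Kx.
  apply: continuous_comp; first exact: Diff_continuous.
  by apply: chart_map_cont; have [] := K_dom _ Kx.
(* [Cr_nbhd] measures closeness in coordinates; the modulus of the chart inverse brings it back to
   [M]. *)
have [|e' e'0 He'] := compact_modulus cfK (f := chart_inv c') _ e0.
  move=> _ [x Kx <-]; apply: chart_inv_cont; exists (f x) => //.
  by have [] := K_dom _ Kx.
have [||||d d0 Hd] := @Cr_nbhd_dr_ball f c c' K e' _ _ cK _ _ e'0.
- exact: chart_at_atlas.
- exact: chart_at_atlas.
- by move=> x /K_dom[].
- by move=> _ [x /K_dom[_ ?] <-].
exists d, (rho / 2); split=> // g x /Hd Ng x0x.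
have Kx : K x by apply: subset_closure.
have [cx c'fx] := K_dom _ Kx; have [c'gx /(_ [::] isT)] := Ng _ Kx.
rewrite /= /local_rep /= chart_mapK // => fg.
rewrite -(chart_mapK c'fx) -(chart_mapK c'gx); apply: He'; first by exists x.
by rewrite -ball_normE.
Qed.

(** Compactness makes the local radii [d] uniform in the point. *)
Lemma dr_ball_close (f : Diff A) (e : R) : 0 < e ->
  exists2 d : R, 0 < d & forall g x, dr f g < d -> ball (f x) e (g x).
Proof.
move=> e0; have /compact_near_coveringP cM' := cM.
have [|d d0 Hd] := cM' R (0^'+)
  (fun d x => forall g, dr f g < d -> ball (f x) e (g x)) _.
  move=> x0 _; have [d [rho [d0 rho0 H]]] := dr_ball_locally_close f x0 e0.
  exists (ball x0 rho, [set d' | d' < d]) => /=.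
    by split; [exact: nbhsx_ballx | exact: nbhs_right_lt].
  move=> [x d'] /= [x0x d'd] g fg; apply: H x0x.
  exact: lt_trans fg d'd.
exists (d / 2) => /=; first by rewrite divr_gt0.
move=> g x; apply: (Hd (d / 2)) => //=; last by rewrite divr_gt0.
rewrite sub0r normrN gtr0_norm ?divr_gt0 //.
by move: d0 => /=; lra.
Qed.

(* [f^-1 y] and [g^-1 y] are the images under [f^-1] of [y = g x] and of [f x],
   where [x = g^-1 y]. *)
Lemma dr_ball_inv_close (f : Diff A) (e : R) : 0 < e ->
  exists2 d : R, 0 < d &
    forall g x, dr f g < d -> ball (Defs.dinv f x) e (Defs.dinv g x).
Proof.
move=> e0.
have [|d d0 Hd] := compact_modulus cM (f := Defs.dinv f) _ e0.
  by move=> x _; exact: dinv_continuous.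
have [d' d'0 Hd'] := dr_ball_close f d0.
exists d' => // g y /(Hd' g (Defs.dinv g y)); rewrite dinvK => fgy.
by rewrite -[Defs.dinv g y](dfunK f); apply: Hd => //; apply: ball_sym.
Qed.

Lemma strong_ball_open (f : Fr A) (eps : int -> R) :
  (forall i, 0 < eps i) -> strong_open dr (strong_ball dr f eps).
Proof.
move=> eps0 g fg; exists [set strong_ball dr f eps]; split.
- exact: finite_set1.
- by move=> _ ->; exists f, eps.
- by move=> _ ->.
- by move=> h; apply.
Qed.

Lemma strong_ball_center (f : Fr A) (eps : int -> R) :
  (forall i, 0 < eps i) -> strong_ball dr f eps f.
Proof.
by move=> eps0 i; have [dr0 _ _ _] := dr_Cr; have /dr0-> : f i = f i.
Qed.

End UniformCloseness.

(** * Local constancy on the strong topology *)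

Section LocalConstancy.
Context (R : realType) (r n : nat) (M : pseudoMetricType R).
Context (X : riemannian_manifold r n M) (dr : Diff X -> Diff X -> R).
Context (cM : compact [set: M]) (dr_Cr : Cr_metric dr).

(* [act] turns a diffeomorphism into the map iterated (itself or its inverse)
   and [pos k] is the index, in the sequence, of the map applied at time [k]. *)
Lemma orbit_entropy_locally_constant
    (act act' : Diff X -> M -> M) (pos idx : nat -> int) :
  injective pos ->
  (forall f, cancel (act f) (act' f)) -> (forall f, cancel (act' f) (act f)) ->
  (forall f, continuous (act f)) -> (forall f, continuous (act' f)) ->
  (forall (f : Diff X) (e : R), 0 < e -> exists2 d : R, 0 < d &
     forall g x, dr f g < d -> ball (act f x) e (act g x)) ->
  locally_constant (strong_open dr) (fun f : Fr X =>
    orbit_entropy X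
      (indexed_orbit (orbit_map (fun k => act (f (pos k)))) idx)).
Proof.
move=> pos_inj actK act'K cact cact' close f.
have [eta [eta0 Heta]] := @orbits_conjugate R M cM
  (fun k => act (f (pos k))) (fun k => act' (f (pos k)))
  (fun k => actK _) (fun k => act'K _) (fun k => cact _) (fun k => cact' _).
(* By injectivity of [pos], each index is met at most once, so it has only one [eta k] to respect;
   indices never met get radius 1. *)
have /choice[eps Heps] : forall i : int, exists d : R, 0 < d /\
    forall k, pos k = i -> forall g x,
      dr (f i) g < d -> ball (act (f i) x) (eta k) (act g x).
  move=> i; have [[k ki]|nk] := pselect (exists k, pos k = i).
    have [d d0 Hd] := close (f i) _ (eta0 k).
    by exists d; split=> // k'; rewrite -ki => /pos_inj ->; rewrite ki.
  by exists 1; split=> // k ki; case: nk; exists k.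
have eps0 i : 0 < eps i by have [] := Heps i.
exists (strong_ball dr f eps); split.
- exact: strong_ball_open.
- exact: strong_ball_center.
move=> g fg.
have H := Heta (fun k => act (g (pos k))) (fun k => act' (g (pos k)))
  (fun k => actK _) (fun k => act'K _) (fun k x =>
    (Heps (pos k)).2 k erefl (g (pos k)) x (fg (pos k))).
(* The map [h] bounds the entropy of [g] by that of [f]; its inverse [h'] exchanges the roles. *)
apply/eqP; rewrite eq_le; apply/andP; split.
  apply: orbit_entropy_le_near => // [j|k].
    by apply: orbit_map_continuous => k.
  by have [h [h' [_ _ Hh]]] := H k; exists h => j x; exact: Hh.
apply: orbit_entropy_le_near => // [j|k].
  by apply: orbit_map_continuous => k.
have [h [h' [_ h'K Hh]]] := H k; exists h' => j x jk.
by have := Hh j (h' x) jk; rewrite h'K; exact: ball_sym.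
Qed.

Lemma fwd_orbitE (f : Fr X) (i : int) : fwd_orbit f i =
  indexed_orbit (orbit_map (fun k => f (i + k%:Z))) (fun k => i + k%:Z).
Proof.
apply/funext => k; apply/funext => x; congr (_, _).
by elim: k => //= k ->.
Qed.

Lemma bwd_orbitE (f : Fr X) (i : int) : bwd_orbit f i =
  indexed_orbit (orbit_map (fun k => Defs.dinv (f (i - k%:Z))))
    (fun k => i - k%:Z + 1).
Proof.
apply/funext => k; apply/funext => x; congr (_, _).
by elim: k => //= k ->.
Qed.

End LocalConstancy.

Theorem theorem6p9 (R : realType) (r n : nat) (M : pseudoMetricType R)
    (X : riemannian_manifold r n M) (dr : Diff X -> Diff X -> R)
    (r_ge1 : (1 <= r)%N)
    (M_compact : compact [set: M]%classic) (M_hausdorff : hausdorff_space M)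
    (dr_Cr : Cr_metric dr) :
  forall i : int,
    locally_constant (strong_open dr) (fun f : Fr X => entropy i f) /\
    locally_constant (strong_open dr) (fun f : Fr X => inv_entropy i f).
Proof.
move=> i; split.
  have -> : (fun f : Fr X => entropy i f) = (fun f => orbit_entropy X
      (indexed_orbit (orbit_map (fun k => f (i + k%:Z))) (fun k => i + k%:Z))).
    by apply/funext => f; rewrite /entropy fwd_orbitE.
  apply: (orbit_entropy_locally_constant M_compact dr_Cr
    (act := @dfun _ _ _ _ _) (act' := @Defs.dinv _ _ _ _ _)).
  - by move=> k k' /addrI [].
  - exact: dfunK.
  - exact: dinvK.
  - exact: Diff_continuous.
  - exact: dinv_continuous.
  - by move=> f e; exact: dr_ball_close.
have -> : (fun f : Fr X => inv_entropy i f) = (fun f => orbit_entropy X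
    (indexed_orbit (orbit_map (fun k => Defs.dinv (f (i - k%:Z))))
      (fun k => i - k%:Z + 1))).
  by apply/funext => f; rewrite /inv_entropy bwd_orbitE.
apply: (orbit_entropy_locally_constant M_compact dr_Cr
  (act := @Defs.dinv _ _ _ _ _) (act' := @dfun _ _ _ _ _)).
- by move=> k k' /addrI /oppr_inj [].
- exact: dinvK.
- exact: dfunK.
- exact: dinv_continuous.
- exact: Diff_continuous.
- by move=> f e; exact: dr_ball_inv_close.
Qed.
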